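(* Fix $c>0$, fix $K\ge2$ and assume $\frac nK\ge2$. Let $\Theta=\Theta(n,K,a,b)$ be the homogeneous balanced SBM parameter class with $K$ communities, within-community edge probability $a/n$, across-community edge probability $b/n$, and balanced labelings in $\Sigma$. For $\theta\in\Theta$, let $\sigma_\theta\in\Sigma$ be a representative ground-truth labeling, and let $\mathbb P_\theta,\mathbb E_\theta$ denote the corresponding SBM probability and expectation (including the internal randomness of the mechanism). 1. If a $\rho$-node-zCDP mechanism $\mathcal M:\mathcal G_n\to[K]^n$ satisfies $\sup_{\theta\in\Theta}\mathbb P_\theta(r(\sigma_\theta,\mathcal M(A))>0)\le n^{-c}$, then $\rho\ge\frac c4\log(n)-\frac14\log(4)$. 2. If a $\rho$-node-zCDP mechanism $\mathcal M:\mathcal G_n\to[K]^n$ satisfies $\sup_{\theta\in\Theta}\mathbb E_\theta r(\sigma_\theta,\mathcal M(A))\le n^{-(1+c)}$, then $\rho\ge\frac c4\log(n)-\frac14\log(4)$.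
   Context: $n,K$ are integers with $K\mid n$. $\mathcal G_n$ is the set of undirected graphs on $[n]=\{1,\dots,n\}$, identified with symmetric zero-diagonal adjacency matrices $A\in\{0,1\}^{n\times n}$. $\Sigma=\{\sigma:[n]\to[K]:|\sigma^{-1}(k)|=n/K\ \forall k\in[K]\}$. The SBM with ground truth $\sigma\in\Sigma$ draws the upper-triangular entries of $A$ independently with $\mathbb P(A_{ij}=1)=a/n$ if $\sigma(i)=\sigma(j)$ and $b/n$ otherwise; the class $\Theta$ consists of the SBMs obtained as $\sigma$ ranges over $\Sigma$. For $\sigma,\tau\in[K]^n$: $h(\sigma,\tau)=|\{i:\sigma_i\ne\tau_i\}|$ and $r(\sigma,\tau)=\frac1n\min_{\pi\in\mathfrak S_K}h(\pi\circ\sigma,\tau)$, with $\mathfrak S_K$ the permutations of $[K]$. Two graphs are node-adjacent, $A\sim_vA'$, if they differ only on edges incident to a single vertex. For $\alpha>1$ and distributions $P,Q$ on a finite set, $D_\alpha(P\|Q)=\frac1{\alpha-1}\log\big(\sum_yP(y)^\alpha Q(y)^{1-\alpha}\big)$. A randomized mechanism $\mathcal M:\mathcal G_n\to[K]^n$ is $\rho$-node-zCDP if $D_\alpha(\mathcal L(\mathcal M(A))\,\|\,\mathcal L(\mathcal M(A')))\le\alpha\rho$ for all $A\sim_vA'$ and all $\alpha>1$, where $\mathcal L(\cdot)$ denotes the law over the mechanism's internal randomness. *)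

(* Defs.v *)
(* MathComp-Analysis, over an arbitrary [R : realType]. Vertices are 'I_n and
   communities are 'I_K, i.e. [n] and [K] numbered from 0. *)
From HB Require Import structures.
From mathcomp Require Import all_boot all_order all_algebra all_fingroup.
From mathcomp Require Import all_classical all_reals all_analysis.

Set Implicit Arguments.
Unset Strict Implicit.
Unset Printing Implicit Defensive.

Import Order.TTheory GRing.Theory Num.Theory.
Local Open Scope ring_scope.

Definition simple_adj (n : nat) (A : 'M[bool]_n) : bool :=
  [forall i, ~~ A i i] && [forall i, forall j, A i j == A j i].

Record graph (n : nat) := Graph {
  adj :> 'M[bool]_n;
  _ : simple_adj adj }.

HB.instance Definition _ (n : nat) := [isSub for @adj n].
HB.instance Definition _ (n : nat) := [Finite of graph n by <:].

(* A and A' agree on every pair avoiding some vertex v; in particular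
   A ~_v A holds. *)
Definition node_adjacent (n : nat) (A A' : graph n) : Prop :=
  exists v : 'I_n, forall i j : 'I_n, i != v -> j != v -> A i j = A' i j.

Definition labeling (n K : nat) := {ffun 'I_n -> 'I_K}.

Definition balanced (n K : nat) : set (labeling n K) :=
  [set s | forall k : 'I_K, #|s @^-1: [set k]%SET| = (n %/ K)%N].

Definition hamming (n K : nat) (s t : labeling n K) : nat :=
  #|[set i | s i != t i]%SET|.

Definition relabel (n K : nat) (p : 'S_K) (s : labeling n K) : labeling n K :=
  [ffun i => p (s i)].

(* The seed [hamming s t] of the iterated minimum is its term at p = 1. *)
Definition misclass (R : realType) (n K : nat) (s t : labeling n K) : R :=
  (\big[minn/hamming s t]_(p : 'S_K) hamming (relabel p s) t)%:R / n%:R.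

Record fdist (R : realType) (T : finType) := FDist {
  pmf :> T -> R;
  pmf_ge0 : forall x, 0 <= pmf x;
  pmf_sum1 : \sum_x pmf x = 1 }.

(* A term of \sum_y P(y)^alpha Q(y)^(1-alpha) for alpha > 1, with the standard
   conventions 0^alpha 0^(1-alpha) = 0 and p^alpha 0^(1-alpha) = +oo for p > 0;
   the case split is needed because [powR 0 x] = 0 for x < 0. *)
Definition renyi_term (R : realType) (alpha p q : R) : \bar R :=
  if q == 0 then (if p == 0 then 0%E else +oo%E)
  else (p `^ alpha * q `^ (1 - alpha))%:E.

Definition renyi_div (R : realType) (T : finType) (alpha : R)
    (P Q : fdist R T) : \bar R :=
  (((alpha - 1)^-1)%:E * lne (\sum_(y : T) renyi_term alpha (P y) (Q y)))%E.

(* A randomized mechanism, given by the law of M(A) for each input A. *)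
Definition mechanism (R : realType) (n K : nat) :=
  graph n -> fdist R (labeling n K).

Definition node_zCDP (R : realType) (n K : nat) (rho : R)
    (M : mechanism R n K) : Prop :=
  forall A A' : graph n, node_adjacent A A' ->
  forall alpha : R, 1 < alpha ->
  (renyi_div alpha (M A) (M A') <= (alpha * rho)%:E)%E.

Definition edge_prob (R : realType) (n K : nat) (a b : R) (s : labeling n K)
    (i j : 'I_n) : R :=
  if s i == s j then a / n%:R else b / n%:R.

Definition sbm (R : realType) (n K : nat) (a b : R) (s : labeling n K)
    (A : graph n) : R :=
  \prod_(e : 'I_n * 'I_n | (e.1 < e.2)%N)
    (if A e.1 e.2 then edge_prob a b s e.1 e.2
     else 1 - edge_prob a b s e.1 e.2).

Lemma sbm_ge0 (R : realType) (n K : nat) (a b : R) (s : labeling n K)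
    (A : graph n) :
  0 <= a / n%:R <= 1 -> 0 <= b / n%:R <= 1 -> 0 <= sbm a b s A.
Proof.
move=> /andP[a0 a1] /andP[b0 b1]; apply: prodr_ge0 => e _.
by rewrite /edge_prob; case: ifP; case: ifP; rewrite ?subr_ge0.
Qed.

Lemma sbm_sum1 (R : realType) (n K : nat) (a b : R) (s : labeling n K) :
  \sum_(A : graph n) sbm a b s A = 1.
Proof.
pose F (e : 'I_n * 'I_n) (x : bool) : R :=
  if x then edge_prob a b s e.1 e.2 else 1 - edge_prob a b s e.1 e.2.
pose U := [pred e : 'I_n * 'I_n | (e.1 < e.2)%N].
have -> : 1 = \prod_(e | U e) \sum_(x : bool | true) F e x :> R.
  rewrite big1 // => e _.
  by rewrite big_bool /F /= addrC subrK.
rewrite (big_distr_big false) /=.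
pose h (A : graph n) : {ffun 'I_n * 'I_n -> bool} :=
  [ffun e : 'I_n * 'I_n => (e.1 < e.2)%N && A e.1 e.2].
pose m (f : {ffun 'I_n * 'I_n -> bool}) : 'M[bool]_n :=
  \matrix_(i, j) (((i < j)%N && f (i, j)) || ((j < i)%N && f (j, i))).
have mP f : simple_adj (m f).
  apply/andP; split; first by apply/forallP => i; rewrite mxE ltnn.
  by apply/forallP => i; apply/forallP => j; rewrite !mxE orbC.
rewrite (reindex h) /=; last first.
  exists (fun f => Graph (mP f)) => [A _|f /pfamilyP[/fintype.subsetP fU _]].
    case/andP: (valP A) => /forallP A0 /forallP AC.
    apply/val_inj/matrixP => i j /=; rewrite mxE !ffunE /=.
    have /eqP := forallP (AC i) j; case: (ltngtP i j) => //= ij AE.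
    - by rewrite orbF.
    - by rewrite (val_inj ij : i = j); apply/esym/negbTE/A0.
  apply/ffunP => -[i j]; rewrite ffunE /= mxE.
  case: (ltngtP i j) => //= ij; rewrite ?orbF //;
    by apply/esym/negP => fij; have := fU (i, j); rewrite !inE fij ltnNge
      ?(ltnW ij) ?ij ?leqnn //= => /(_ isT).
apply: eq_big => [A|A _].
  apply/esym/pfamilyP; split => // ; apply/fintype.subsetP => e.
  by rewrite !inE ffunE; case: (e.1 < e.2)%N.
by apply: eq_bigr => e e12; rewrite /F ffunE e12.
Qed.

(* Probability and expectation under P_theta: A is drawn from the SBM with
   ground truth s, then t from the law M A. *)
Definition sbm_prob (R : realType) (n K : nat) (a b : R) (s : labeling n K)
    (M : mechanism R n K) (E : pred (labeling n K)) : R :=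
  \sum_(A : graph n) sbm a b s A * \sum_(t : labeling n K | E t) M A t.

Definition sbm_expect (R : realType) (n K : nat) (a b : R) (s : labeling n K)
    (M : mechanism R n K) (X : labeling n K -> R) : R :=
  \sum_(A : graph n) sbm a b s A * \sum_(t : labeling n K) M A t * X t.

(* Main.v *)
(* Take a balanced labeling s and let t be s with two vertices i, j from
   different communities exchanged. If A is drawn from the SBM with truth s, then
   A with i and j transposed is drawn from the SBM with truth t, so the two
   models are coupled by graphs that are two node-adjacency steps apart. Writing
   KL(P||Q) = KL(P||W) + E_P ln(W/Q) and applying Jensen to the last term gives
   KL(P||Q) <= 2 KL(P||W) + D_2(W||Q), so the outputs on coupled graphs have KL
   divergence at most 4 rho. If E is exact recovery of t, then P_t(E) >= 1 - n^-c
   and P_s(E) <= n^-c, since no labeling is equivalent to both s and t. The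
   Donsker-Varadhan bound L P_t(E) - ln(1 + e^L P_s(E)) <= 4 rho with L = c ln n
   and L e^-L <= 1/2 <= ln 2 give L - 2 ln 2 <= 4 rho. An expected error rate
   reduces to this by Markov, as a nonzero error rate is at least 1/n. *)
Require Import Defs.
From mathcomp Require Import all_boot all_order all_algebra all_fingroup.
From mathcomp Require Import all_classical all_reals all_analysis.
From mathcomp Require Import ring lra.
Import Order.TTheory GRing.Theory Num.Theory.
Local Open Scope classical_set_scope.
Local Open Scope ring_scope.

(** * Jensen's inequality and bounds on Kullback-Leibler divergence *)

Lemma sum_mul_ln_le_ln {R : realType} {I : finType} (p x : I -> R) (B : R) :
  (forall i, 0 <= p i) -> \sum_i p i = 1 ->
  (forall i, 0 <= x i) -> (forall i, 0 < p i -> 0 < x i) ->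
  \sum_i p i * x i <= B -> \sum_i p i * ln (x i) <= ln B.
Proof.
move=> p0 p1 x0 xp; set S := \sum_i p i * x i => SB.
have px0 i : 0 <= p i * x i by rewrite mulr_ge0.
have S0 : 0 < S.
  rewrite lt_def sumr_ge0 // andbT; apply/eqP => S0.
  have /eqP := oner_neq0 R; apply; rewrite -p1 big1 // => i _.
  have pxi : p i * x i = 0 by apply: (psumr_eq0P _ S0).
  have := p0 i; rewrite le_eqVlt => /predU1P[<- //|pi].
  by have := mulr_gt0 pi (xp i pi); rewrite pxi ltxx.
apply: le_trans (_ : ln S <= _); last first.
  by rewrite ler_ln // posrE // (lt_le_trans S0).
(* The tangent line at the mean [S] gives [ln (x i) <= ln S + (x i / S - 1)], and the corrections
   average to [0]. *)
have -> : ln S = \sum_i p i * (ln S + (x i / S - 1)).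
  under eq_bigr do rewrite mulrDr mulrBr mulr1 mulrA.
  rewrite big_split /= sumrB -!mulr_suml p1 mul1r divff ?gt_eqF //.
  by rewrite subrr addr0.
apply: ler_sum => i _; have := p0 i; rewrite le_eqVlt => /predU1P[<-|pi].
  by rewrite !mul0r.
have xi := xp i pi; apply: ler_wpM2l => //.
rewrite -lerBlDl -ln_div ?posrE //.
have := @le_ln1Dx _ (x i / S - 1); rewrite (addrC 1) subrK; apply.
by rewrite ltrBrDl subrr divr_gt0.
Qed.

Section KullbackLeibler.
Context {R : realType} {T : finType}.
Implicit Types P Q W : fdist R T.

(* Meaningful only when [abs_cont P Q]: a term with [Q y = 0] is [0], not [+oo]. *)
Definition kl P Q : R := \sum_y P y * ln (P y / Q y).

Definition abs_cont P Q : Prop := forall y, Q y = 0 -> P y = 0.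

Lemma abs_cont_gt0 P Q y : abs_cont P Q -> 0 < P y -> 0 < Q y.
Proof.
move=> PQ Py; rewrite lt_def Defs.pmf_ge0 andbT; apply/eqP => /PQ Py0.
by rewrite Py0 ltxx in Py.
Qed.

(** A point with [Q y = 0 < P y] makes the Rényi sum [+oo], so a finite bound forces absolute
    continuity, after which every term is real. *)
Lemma renyi_div_le P Q (alpha B : R) :
  1 < alpha -> (renyi_div alpha P Q <= B%:E)%E ->
  abs_cont P Q /\
  ln (\sum_y P y `^ alpha * Q y `^ (1 - alpha)) <= (alpha - 1) * B.
Proof.
move=> a1; rewrite /renyi_div => D.
have a10 : 0 < alpha - 1 by rewrite subr_gt0.
have term0 y : (0 <= renyi_term alpha (P y) (Q y))%E.
  rewrite /renyi_term; case: ifP => _; first by case: ifP.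
  by rewrite lee_fin mulr_ge0 ?powR_ge0.
have PQ : abs_cont P Q.
  move=> y Qy; apply/eqP/negPn/negP => Py; move: D.
  suff -> : (\sum_y0 renyi_term alpha (P y0) (Q y0) = +oo)%E.
    by rewrite /= gt0_muley ?lte_fin ?invr_gt0 // leye_eq.
  apply/eqP; rewrite esum_eqy => [|i _]; last first.
    by rewrite gt_eqF // (lt_le_trans _ (term0 i)).
  by apply/existsP; exists y; rewrite /= /renyi_term Qy eqxx (negPf Py).
split=> //; move: D; set S : R := \sum_y P y `^ alpha * _.
have -> : (\sum_y renyi_term alpha (P y) (Q y) = S%:E)%E.
  rewrite /S -sumEFin; apply: eq_bigr => y _; rewrite /renyi_term.
  case: ifPn => // /eqP Qy; rewrite (PQ y Qy) eqxx powR0 ?mul0r //.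
  by rewrite gt_eqF // (lt_trans _ a1).
rewrite lee_pdivrMl // -EFinM.
have [S0|S0] := ltP 0 S; first by rewrite lne_EFin // lee_fin.
(* [lne 0] is [-oo] but [ln 0] is [0], so [S = 0] has to be excluded: it would make [P] vanish
   identically. *)
have S00 : S = 0.
  by apply/eqP; rewrite eq_le S0 sumr_ge0 // => y _; rewrite mulr_ge0 ?powR_ge0.
suff : \sum_y P y = 0 by rewrite Defs.pmf_sum1 => /eqP; rewrite oner_eq0.
apply: big1 => y _; apply/eqP/negPn/negP => Py.
have Py0 : 0 < P y by rewrite lt_def Py Defs.pmf_ge0.
have Qy0 := abs_cont_gt0 _ _ _ PQ Py0.
have Sy : P y `^ alpha * Q y `^ (1 - alpha) = 0.
  by apply: (psumr_eq0P _ S00) => // i _; rewrite mulr_ge0 ?powR_ge0.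
have := mulr_gt0 (powR_gt0 alpha Py0) (powR_gt0 (1 - alpha) Qy0).
by rewrite Sy ltxx.
Qed.

(** Jensen under [P] for [(P / Q) ^ (alpha - 1)], whose mean is the Rényi sum. *)
Lemma kl_le_renyi P Q (alpha : R) : abs_cont P Q -> 1 < alpha ->
  (alpha - 1) * kl P Q <= ln (\sum_y P y `^ alpha * Q y `^ (1 - alpha)).
Proof.
move=> PQ a1.
have -> : (alpha - 1) * kl P Q
    = \sum_y P y * ln ((P y / Q y) `^ (alpha - 1)).
  by rewrite mulr_sumr; apply: eq_bigr => y _; rewrite ln_powR mulrCA.
have -> : \sum_y P y `^ alpha * Q y `^ (1 - alpha)
    = \sum_y P y * (P y / Q y) `^ (alpha - 1).
  apply: eq_bigr => y _.
  have := Defs.pmf_ge0 P y; rewrite le_eqVlt => /predU1P[<-|Py].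
    by rewrite powR0 ?mul0r // gt_eqF // (lt_trans _ a1).
  have Qy := abs_cont_gt0 _ _ _ PQ Py.
  rewrite powRM ?invr_ge0 ?ltW // -powR_inv1 ?ltW // -powRrM mulN1r opprB.
  rewrite mulrA; congr (_ * _).
  rewrite -{2}[P y](powRr1 (ltW Py)) -powRD ?(gt_eqF Py) ?implybT //.
  by rewrite addrC subrK.
apply: sum_mul_ln_le_ln => [y||y|y Py|]; rewrite ?Defs.pmf_ge0 ?Defs.pmf_sum1 ?powR_ge0 //.
by rewrite powR_gt0 // divr_gt0 // (abs_cont_gt0 _ _ _ PQ).
Qed.

(** Stands in for the triangle inequality, which [kl] lacks. Under [P] the mean of [W^2 / (P Q)] is
    at most the sum of [W^2 / Q], the exponential of [D_2(W || Q)]. *)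
Lemma kl_le_kl_chi2 P W Q : abs_cont P W -> abs_cont W Q ->
  kl P Q <= 2 * kl P W + ln (\sum_y W y `^ 2 * Q y `^ (1 - 2)).
Proof.
move=> PW WQ.
have posP y : 0 < P y -> 0 < W y /\ 0 < Q y.
  by move=> /(abs_cont_gt0 _ _ _ PW) Wy; have := abs_cont_gt0 _ _ _ WQ Wy.
rewrite -lerBlDl.
have -> : kl P Q - 2 * kl P W
    = \sum_y P y * ln (W y ^+ 2 / (P y * Q y)).
  rewrite mulr_sumr -sumrB; apply: eq_bigr => y _.
  have := Defs.pmf_ge0 P y; rewrite le_eqVlt => /predU1P[<-|Py].
    by rewrite !mul0r mulr0 subrr.
  have [Wy Qy] := posP y Py.
  rewrite !ln_div ?posrE ?exprn_gt0 ?mulr_gt0 // lnM ?posrE //.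
  by rewrite lnXn // mulr2n; ring.
apply: sum_mul_ln_le_ln => [y||y|y Py|].
- exact: Defs.pmf_ge0.
- exact: Defs.pmf_sum1.
- by rewrite divr_ge0 ?exprn_ge0 ?mulr_ge0 ?Defs.pmf_ge0.
- by have [Wy Qy] := posP y Py; rewrite divr_gt0 ?exprn_gt0 ?mulr_gt0.
apply: ler_sum => y _.
have -> : 1 - 2 = -1 :> R by ring.
rewrite powR_inv1 ?Defs.pmf_ge0 // powR_mulrn ?Defs.pmf_ge0 //.
have := Defs.pmf_ge0 P y; rewrite le_eqVlt => /predU1P[<-|Py].
  by rewrite mul0r divr_ge0 ?exprn_ge0 ?Defs.pmf_ge0.
by rewrite invfM mulrCA mulVKf ?gt_eqF.
Qed.

(** Donsker-Varadhan with the test function equal to [L] on [E] and [0] elsewhere. *)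
Lemma kl_event P Q (E : pred T) (L : R) : abs_cont P Q ->
  L * (\sum_(y | E y) P y) - kl P Q <= ln (1 + expR L * \sum_(y | E y) Q y).
Proof.
move=> PQ; pose g y : R := if E y then expR L else 1.
have g0 y : 0 < g y by rewrite /g; case: ifP; rewrite ?expR_gt0.
have -> : L * (\sum_(y | E y) P y) - kl P Q
    = \sum_y P y * ln (Q y / P y * g y).
  rewrite mulr_sumr [X in X - _]big_mkcond -sumrB; apply: eq_bigr => y _.
  have := Defs.pmf_ge0 P y; rewrite le_eqVlt => /predU1P[<-|Py].
    by rewrite !mul0r mulr0 subr0; case: ifP.
  have Qy := abs_cont_gt0 _ _ _ PQ Py.
  rewrite [ln (_ * g y)]lnM ?posrE ?divr_gt0 // !ln_div ?posrE //.
  by rewrite /g; case: ifP; rewrite ?expRK ?ln1 => _; ring.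
apply: sum_mul_ln_le_ln => [y||y|y Py|].
- exact: Defs.pmf_ge0.
- exact: Defs.pmf_sum1.
- by rewrite mulr_ge0 ?divr_ge0 ?Defs.pmf_ge0 // ltW.
- by rewrite mulr_gt0 // divr_gt0 // (abs_cont_gt0 _ _ _ PQ).
rewrite -(Defs.pmf_sum1 Q) mulr_sumr [X in _ + X]big_mkcond -big_split /=.
(* Where [P y = 0] the quotient [Q y / P y] is [0] by default, hence an inequality. *)
apply: ler_sum => y _; apply: le_trans (_ : Q y * g y <= _).
  have := Defs.pmf_ge0 P y; rewrite le_eqVlt => /predU1P[<-|Py].
    by rewrite mul0r mulr_ge0 ?Defs.pmf_ge0 // ltW.
  by rewrite mulrA (mulrC (P y)) divfK ?gt_eqF.
rewrite /g; case: ifP => _; last by rewrite mulr1 addr0.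
by rewrite mulrC lerDr Defs.pmf_ge0.
Qed.

End KullbackLeibler.

(** * Action of vertex permutations on graphs and on the SBM *)

Section VertexPermutation.
Context {n : nat}.
Implicit Types (A : graph n) (p : 'S_n).

Lemma permute_simple A p : simple_adj (\matrix_(i, j) A (p i) (p j)).
Proof.
have /andP[/forallP A0 /forallP As] := valP A.
apply/andP; split; apply/forallP => i; rewrite ?mxE //.
by apply/forallP => j; rewrite !mxE; have /forallP := As (p i); apply.
Qed.

Definition permute p A : graph n := Graph (permute_simple A p).

Lemma permuteE p A i j : permute p A i j = A (p i) (p j).
Proof. by rewrite /= mxE. Qed.

Lemma permute_bij p : bijective (permute p).
Proof.
by exists (permute p^-1%g) => A; apply/val_inj/matrixP => i j;
  rewrite /= !mxE ?permKV ?permK.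
Qed.

Lemma graphC A i j : A i j = A j i.
Proof. by have /andP[_ /forallP/(_ i)/forallP/(_ j)/eqP] := valP A. Qed.

(** Sorting the image under [p] of each pair [i < j] permutes these pairs, and the symmetry of [F]
    makes the sorting harmless. *)
Lemma prod_lt_perm {R : realType} (p : 'S_n) (F : 'I_n -> 'I_n -> R) :
  (forall i j, F i j = F j i) ->
  \prod_(e : 'I_n * 'I_n | (e.1 < e.2)%N) F (p e.1) (p e.2)
  = \prod_(e : 'I_n * 'I_n | (e.1 < e.2)%N) F e.1 e.2.
Proof.
move=> FC.
pose h (q : 'S_n) (e : 'I_n * 'I_n) :=
  if (q e.1 < q e.2)%N then (q e.1, q e.2) else (q e.2, q e.1).
have hlt (q : 'S_n) (e : 'I_n * 'I_n) :
    (e.1 < e.2)%N -> ((h q e).1 < (h q e).2)%N.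
  move=> e12; rewrite /h; case: ifPn => //=; rewrite -leqNgt leq_eqVlt.
  case/orP => // /eqP/val_inj/perm_inj e21.
  by rewrite e21 ltnn in e12.
have hK (q q' : 'S_n) : cancel q q' -> forall e : 'I_n * 'I_n,
    (e.1 < e.2)%N -> h q' (h q e) = e.
  move=> qK [i j] /= ij; rewrite /h /=.
  by case: (q i < q j)%N => /=; rewrite !qK ?ij // ltnNge (ltnW ij).
rewrite [RHS](reindex_onto (h p) (h p^-1%g)) /=; last first.
  by move=> e e12; apply: hK e12; apply: permKV.
apply: eq_big => [e|e _]; last by rewrite /h; case: ifP => _ //=.
apply/idP/andP => [e12|[e12 /eqP <-]].
  by rewrite hlt // (hK _ _ (permK p)).
exact: hlt.
Qed.

End VertexPermutation.

Lemma sbm_permute {R : realType} {n K : nat} (a b : R) (s : labeling n K)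
    (p : 'S_n) (A : graph n) :
  sbm a b [ffun i => s (p i)] (permute p A) = sbm a b s A.
Proof.
pose F i j : R := if A i j then edge_prob a b s i j else 1 - edge_prob a b s i j.
rewrite /sbm -[RHS](prod_lt_perm p F) => [|i j].
  by apply: eq_bigr => e _; rewrite permuteE /F /edge_prob !ffunE.
by rewrite /F (graphC A i j) /edge_prob (eq_sym (s i)).
Qed.

(** The coupling: with [A] drawn under [s], the graph [permute p A] follows the model of the
    permuted labeling. *)
Lemma sbm_prob_permute {R : realType} {n K : nat} (a b : R) (s : labeling n K)
    (p : 'S_n) (M : mechanism R n K) (E : pred (labeling n K)) :
  sbm_prob a b [ffun i => s (p i)] M E
  = \sum_A sbm a b s A * \sum_(t | E t) M (permute p A) t.
Proof.
rewrite /sbm_prob (reindex (permute p)); last exact/onW_bij/permute_bij.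
by apply: eq_bigr => A _; rewrite sbm_permute.
Qed.

(* [B] has the edges at [i] of the transposed graph and the other edges of [A]. *)
Lemma permute_tperm_adjacent {n : nat} (A : graph n) (i j : 'I_n) :
  exists B : graph n,
    node_adjacent (permute (tperm i j) A) B /\ node_adjacent B A.
Proof.
pose A' := permute (tperm i j) A.
pose B := \matrix_(x, y) if (x == i) || (y == i) then A' x y else A x y.
have BP : simple_adj B.
  have /andP[/forallP A0 _] := valP A.
  have /andP[/forallP A'0 _] := valP A'.
  apply/andP; split; apply/forallP => x; first by rewrite mxE; case: ifP.
  apply/forallP => y; rewrite !mxE orbC; case: ifP => _; apply/eqP/(graphC A).
exists (Graph BP); split.
  (* A pair meeting [i] agrees by construction; a pair avoiding [i] and [j] is fixed by the
     transposition. *)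
  exists j => x y xj yj; rewrite [adj (Graph BP) x y]mxE; case: ifPn => //.
  rewrite negb_or => /andP[xi yi].
  by rewrite permuteE !tpermD // eq_sym.
by exists i => x y xi yi; rewrite mxE (negPf xi) (negPf yi).
Qed.

(** * Error rates and balanced labelings *)

Section Labelings.
Context {n K : nat}.
Implicit Types s t : labeling n K.

Lemma misclass_eq0 (R : realType) s t : (0 < n)%N ->
  misclass R s t = 0 -> exists p, relabel p s = t.
Proof.
move=> n0 /eqP; rewrite mulf_eq0 invr_eq0 !pnatr_eq0 (gtn_eqF n0) orbF.
have ham0 u : hamming u t = 0%N -> u = t.
  move/eqP; rewrite cards_eq0 => /eqP/setP ut; apply/ffunP => i.
  by have := ut i; rewrite !inE => /negbFE/eqP.
(* A minimum is one of its arguments, so a zero minimum is attained at some permutation. *)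
move=> /eqP; apply: (big_ind (fun m => m = 0%N -> exists p, relabel p s = t)).
- by move/ham0 <-; exists 1%g; apply/ffunP => i; rewrite ffunE perm1.
- by move=> x y IHx IHy; rewrite /minn; case: ifP => _; [apply: IHx|apply: IHy].
- by move=> p _ /ham0; exists p.
Qed.

Lemma misclass_ge_inv (R : realType) s t :
  0 < misclass R s t -> n%:R^-1 <= misclass R s t.
Proof.
rewrite /misclass; set m := \big[_/_]_p _.
case: m => [|m]; first by rewrite mul0r ltxx.
by move=> _; rewrite ler_peMl // ?invr_ge0 // ler1n.
Qed.

Lemma misclass_ge0 (R : realType) s t : 0 <= misclass R s t.
Proof. by rewrite divr_ge0. Qed.

Lemma balanced_permute s (p : 'S_n) :
  balanced s -> balanced [ffun i => s (p i)].
Proof.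
move=> sb k; rewrite -[RHS](sb k) -[RHS](on_card_preimset (f := p)).
  by apply: eq_card => i; rewrite !inE ffunE.
by apply: onW_bij; apply: Bijective (permK p) (permKV p).
Qed.

(* Transposing two vertices [i], [j] from different communities breaks up the
   pair [i], [i'] of equally labelled vertices. *)
Lemma exists_balanced_swap : (2 <= K)%N -> (K %| n)%N -> (2 <= n %/ K)%N ->
  exists (s : labeling n K) (i j : 'I_n), balanced s /\
    forall p q : 'S_K, relabel p [ffun x => s (tperm i j x)] != relabel q s.
Proof.
move=> K2 Kn m2; set m := (n %/ K)%N in m2.
(* Vertices are identified with pairs of a community and a position in it. *)
have nE : (n = #|{: 'I_K * 'I_m}|)%N.
  by rewrite card_prod !card_ord mulnC divnK.
pose f (x : 'I_n) : 'I_K * 'I_m := enum_val (cast_ord nE x).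
pose g (u : 'I_K * 'I_m) : 'I_n := cast_ord (esym nE) (enum_rank u).
have gK : cancel g f by move=> u; rewrite /f /g cast_ordKV enum_rankK.
have fK : cancel f g by move=> x; rewrite /f /g enum_valK cast_ordK.
pose s : labeling n K := [ffun x => (f x).1].
pose k0 : 'I_K := Ordinal (ltnW K2); pose k1 : 'I_K := Ordinal K2.
pose l0 : 'I_m := Ordinal (ltnW m2); pose l1 : 'I_m := Ordinal m2.
exists s, (g (k0, l0)), (g (k1, l0)); split=> [k|p q].
  transitivity #|f @^-1: [set u | u.1 == k]%SET|.
    by apply: eq_card => x; rewrite !inE ffunE.
  rewrite on_card_preimset; last by apply: onW_bij; apply: Bijective fK gK.
  transitivity #|finset.setX [set k]%SET [set: 'I_m]%SET|.
    by apply: eq_card => u; rewrite !inE andbT.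
  by rewrite cardsX cards1 cardsT card_ord mul1n.
have g_inj := can_inj gK.
(* The two evaluations give [p k1 = q k0] and [p k0 = q k0], against injectivity of [p]. *)
apply/eqP => /ffunP pq.
have := pq (g (k0, l0)); rewrite !ffunE tpermL !gK /=.
have := pq (g (k0, l1)); rewrite !ffunE tpermD; last 2 first.
- by apply/eqP => /g_inj.
- by apply/eqP => /g_inj.
by rewrite !gK /= => <- /perm_inj.
Qed.

End Labelings.

(** * Consequences of node-zCDP *)

Section NodeZCDP.
Context {R : realType} {n K : nat} {rho : R} {M : mechanism R n K}
  (Mrho : node_zCDP rho M).

(** For every [alpha > 1], [kl] is at most [alpha * rho]; let [alpha] tend to [1]. *)
Lemma zCDP_kl_le (A A' : graph n) : node_adjacent A A' ->
  abs_cont (M A) (M A') /\ kl (M A) (M A') <= rho.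
Proof.
move=> AA'; have div_le (alpha : R) (a1 : 1 < alpha) :=
  renyi_div_le _ _ _ _ a1 (Mrho _ _ AA' _ a1).
have [ac _] := div_le 2 (ltr1n R 2); split=> //.
apply/ler_addgt0Pr => e e0; pose d := e / (`|rho| + 1).
have r0 : 0 < `|rho| + 1 by rewrite ltr_wpDl.
have d0 : 0 < d by rewrite divr_gt0.
have a1 : 1 < 1 + d by rewrite ltrDl.
have [_ le_ln] := div_le _ a1.
have := le_trans (kl_le_renyi _ _ _ ac a1) le_ln.
rewrite ler_pM2l ?subr_gt0 // => /le_trans; apply.
rewrite mulrDl mul1r lerD2l /d mulrAC ler_pdivrMr // ler_pM2l //.
by rewrite (le_trans (ler_norm _)) // lerDl.
Qed.

(** The first step contributes [2 * rho] through the doubled [kl], the second [2 * rho] through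
    [D_2]. *)
Lemma zCDP_kl_le2 (A B A' : graph n) :
  node_adjacent A B -> node_adjacent B A' ->
  abs_cont (M A) (M A') /\ kl (M A) (M A') <= 4 * rho.
Proof.
move=> AB BA'; have [ac1 kl1] := zCDP_kl_le _ _ AB.
have [ac2 chi2] := renyi_div_le _ _ _ _ (ltr1n R 2) (Mrho _ _ BA' _ (ltr1n R 2)).
split=> [y /ac2 /ac1 //|].
by apply: le_trans (kl_le_kl_chi2 _ _ _ ac1 ac2) _; lra.
Qed.

(** [kl_event] is applied to each coupled pair of graphs; Jensen then moves the average over [A]
    inside [ln]. *)
Lemma zCDP_swap_event (a b : R) (s : labeling n K) (i j : 'I_n)
    (E : pred (labeling n K)) (L : R) :
  0 <= a / n%:R <= 1 -> 0 <= b / n%:R <= 1 ->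
  L * sbm_prob a b [ffun x => s (tperm i j x)] M E - 4 * rho
  <= ln (1 + expR L * sbm_prob a b s M E).
Proof.
move=> ha hb; rewrite sbm_prob_permute /sbm_prob.
set m := fun A => \sum_(t | E t) M (permute (tperm i j) A) t.
pose q A := 1 + expR L * \sum_(t | E t) M A t.
have q0 A : 0 < q A.
  rewrite ltr_wpDr // mulr_ge0 ?expR_ge0 ?sumr_ge0 // => t _.
  exact: Defs.pmf_ge0.
apply: le_trans (_ : \sum_A sbm a b s A * ln (q A) <= _); last first.
  apply: sum_mul_ln_le_ln => [A||A|A _|] //; first exact: sbm_ge0.
  - exact: sbm_sum1.
  - exact: ltW.
  under eq_bigr do rewrite /q mulrDr mulr1 mulrCA.
  by rewrite big_split /= sbm_sum1 mulr_sumr.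
have -> : L * (\sum_A sbm a b s A * m A) - 4 * rho
    = \sum_A sbm a b s A * (L * m A - 4 * rho).
  under [RHS]eq_bigr do rewrite mulrBr mulrCA.
  by rewrite sumrB -mulr_suml sbm_sum1 mul1r mulr_sumr.
apply: ler_sum => A _; apply: ler_wpM2l; first exact: sbm_ge0.
have [B [AB BA]] := permute_tperm_adjacent A i j.
have [ac klA] := zCDP_kl_le2 _ _ _ AB BA.
by apply: le_trans (kl_event _ _ E L ac); rewrite lerB.
Qed.

End NodeZCDP.

(** * Two numerical inequalities *)

Lemma mul_expRN_le_half {R : realType} (x : R) : x * expR (- x) <= 1 / 2.
Proof.
have [x0|x0] := leP x 0.
  by rewrite (le_trans (_ : _ <= 0)) // mulr_le0_ge0 // expR_ge0.
rewrite expRN ler_pdivrMr ?expR_gt0 //.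
(* [expR x >= (1 + x / 2)^2 >= 2 * x], the latter because [(1 - x / 2)^2 >= 0]. *)
have h : (1 + x / 2) ^+ 2 <= expR (x / 2) ^+ 2.
  by apply: lerXn2r (expR_ge1Dx _); rewrite nnegrE ?expR_ge0 //; lra.
have x2 : 0 <= (1 - x / 2) ^+ 2 := sqr_ge0 _.
have -> : expR x = expR (x / 2) ^+ 2 by rewrite expr2 -expRD -splitr.
by rewrite mul1r mulrC ler_pdivlMr //; lra.
Qed.

Lemma half_le_ln2 {R : realType} : 1 / 2 <= ln 2 :> R.
Proof.
have := @le_ln1Dx R (- (1 / 2)).
rewrite (_ : 1 + - (1 / 2) = 2^-1 :> R); last by lra.
by rewrite lnV ?posrE // lerN2; apply; lra.
Qed.

(** * Lower bounds from exact recovery and from the expected error *)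

Lemma sbm_prob_le {R : realType} {n K : nat} (a b : R) (s : labeling n K)
    (M : mechanism R n K) (E F : pred (labeling n K)) :
  0 <= a / n%:R <= 1 -> 0 <= b / n%:R <= 1 -> (forall t, E t -> F t) ->
  sbm_prob a b s M E <= sbm_prob a b s M F.
Proof.
move=> ha hb EF; apply: ler_sum => A _; apply: ler_wpM2l; first exact: sbm_ge0.
rewrite big_mkcond [leRHS]big_mkcond; apply: ler_sum => t _.
by have := EF t; case: (E t) => [->//|_]; case: ifP; rewrite ?Defs.pmf_ge0.
Qed.

Lemma sbm_probC {R : realType} {n K : nat} (a b : R) (s : labeling n K)
    (M : mechanism R n K) (E : pred (labeling n K)) :
  sbm_prob a b s M (fun t => ~~ E t) = 1 - sbm_prob a b s M E.
Proof.
rewrite -(sbm_sum1 a b s) -sumrB; apply: eq_bigr => A _.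
rewrite -[X in X - _]mulr1 -mulrBr -(Defs.pmf_sum1 (M A)).
by rewrite [X in X - _](bigID E) /= addrC addrK.
Qed.

Lemma exact_recovery_lower_bound {R : realType} {c : R} {n K : nat} {a b : R}
    {rho : R} {M : mechanism R n K} :
  0 < c -> (2 <= K)%N -> (K %| n)%N -> (2 <= n %/ K)%N ->
  0 <= a / n%:R <= 1 -> 0 <= b / n%:R <= 1 -> node_zCDP rho M ->
  (forall s : labeling n K, balanced s ->
     sbm_prob a b s M (fun t => (0 : R) < misclass R s t) <= n%:R `^ (- c)) ->
  c / 4 * ln n%:R - 1 / 4 * ln 4 <= rho.
Proof.
move=> c0 K2 Kn m2 ha hb Mrho err.
have n0 : (0 < n)%N by move: m2; case: (n) => //; rewrite div0n.
have [s [i [j [sb sep]]]] := exists_balanced_swap K2 Kn m2.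
set t := [ffun x => s (tperm i j x)] in sep.
pose E y := ~~ (0 < misclass R t y).
pose L := c * ln (n%:R : R).
have L0 : 0 <= L by rewrite mulr_ge0 ?ln_ge0 ?ler1n // ltW.
have powE : n%:R `^ (- c) = expR (- L) :> R.
  by rewrite /powR pnatr_eq0 gtn_eqF // mulNr.
have Pt : 1 - expR (- L) <= sbm_prob a b t M E.
  by rewrite sbm_probC lerB // -powE; apply/err/balanced_permute.
have Ps : sbm_prob a b s M E <= expR (- L).
  rewrite -powE; apply: le_trans (err s sb); apply: sbm_prob_le => // y.
  rewrite /E -leNgt => ty; rewrite lt_def misclass_ge0 andbT; apply/eqP => sy.
  have [|p tp] := misclass_eq0 R t y n0.
    by apply/eqP; rewrite eq_le ty misclass_ge0.
  have [q sq] := misclass_eq0 R s y n0 sy.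
  by have /eqP := sep p q; apply; rewrite tp sq.
have := zCDP_swap_event Mrho a b s i j E L ha hb; rewrite -/t.
(* The choice of [L] makes [expR L] times the bound on [P_s(E)] equal to [1]. *)
have : ln (1 + expR L * sbm_prob a b s M E) <= ln 2.
  have Ps0 : 0 <= expR L * sbm_prob a b s M E.
    rewrite mulr_ge0 ?expR_ge0 // sumr_ge0 // => A _.
    by rewrite mulr_ge0 ?sbm_ge0 ?sumr_ge0 // => y _; apply: Defs.pmf_ge0.
  rewrite ler_ln ?posrE // ?ltr_wpDr // lerD2l -(expRxMexpNx_1 L).
  by rewrite ler_wpM2l ?expR_ge0.
have : L * (1 - expR (- L)) <= L * sbm_prob a b t M E by rewrite ler_wpM2l.
have := mul_expRN_le_half L; have := @half_le_ln2 R.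
have -> : ln 4 = 2 * ln 2 :> R.
  by rewrite (_ : 4 = 2 ^+ 2 :> R) ?lnXn ?mulr_natl // -natrX.
have -> : c / 4 * ln n%:R = L / 4 by rewrite /L; lra.
lra.
Qed.

Lemma sbm_prob_misclass_le {R : realType} {n K : nat} (a b : R)
    (s : labeling n K) (M : mechanism R n K) : (0 < n)%N ->
  0 <= a / n%:R <= 1 -> 0 <= b / n%:R <= 1 ->
  sbm_prob a b s M (fun t => (0 : R) < misclass R s t)
  <= n%:R * sbm_expect a b s M (fun t => misclass R s t).
Proof.
move=> n0 ha hb; rewrite mulr_sumr; apply: ler_sum => A _.
rewrite mulrCA ler_wpM2l ?sbm_ge0 // mulr_sumr big_mkcond; apply: ler_sum => t _.
have nR : 0 < n%:R :> R by rewrite ltr0n.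
case: ifPn => [/misclass_ge_inv|_]; last first.
  by rewrite !mulr_ge0 ?Defs.pmf_ge0 ?misclass_ge0.
rewrite -[n%:R^-1]mul1r ler_pdivrMr // => le1.
by rewrite mulrCA ler_peMr ?Defs.pmf_ge0 // mulrC.
Qed.

Theorem corollary4 (R : realType) (c : R) (hc : 0 < c) (n K : nat)
  (hK : (2 <= K)%N) (hKn : (K %| n)%N) (hnK : (2 <= n %/ K)%N)
  (a b : R) (ha : 0 <= a / n%:R <= 1) (hb : 0 <= b / n%:R <= 1) :
  (forall (rho : R) (M : mechanism R n K), node_zCDP rho M ->
     (ereal_sup [set (sbm_prob a b s M (fun t => (0 : R) < misclass R s t))%:E
                | s in @balanced n K] <= (n%:R `^ (- c))%:E)%E ->
     c / 4 * ln n%:R - 1 / 4 * ln 4 <= rho)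
  /\
  (forall (rho : R) (M : mechanism R n K), node_zCDP rho M ->
     (ereal_sup [set (sbm_expect a b s M (fun t => misclass R s t))%:E
                | s in @balanced n K] <= (n%:R `^ (- (1 + c)))%:E)%E ->
     c / 4 * ln n%:R - 1 / 4 * ln 4 <= rho).
Proof.
have n0 : (0 < n)%N by move: hnK; case: (n) => //; rewrite div0n.
split=> rho M Mrho /ereal_supP err;
  apply: (exact_recovery_lower_bound hc hK hKn hnK ha hb Mrho) => s sb.
  by rewrite -lee_fin; apply: err; exists s.
apply: le_trans (sbm_prob_misclass_le _ _ _ _ n0 ha hb) _.
(* Splitting off [n^-1] cancels the factor [n] of Markov's inequality. *)
rewrite opprD powRD ?pnatr_eq0 ?gtn_eqF ?implybT // powR_inv1 // in err.
have nR : 0 < n%:R :> R by rewrite ltr0n.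
rewrite mulrC -ler_pdivlMr // mulrC -lee_fin.
by apply: err; exists s.
Qed.
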